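(* Let $v, w \in \mathbb{R}^n$ where $v$ has pairwise distinct coordinates. Then \[ \mathcal{O}(v,w) := \#\{\sigma \in S_n : w \cdot \sigma v = 0\} \leq \operatorname{comp}(w)!\, M\!\left(\begin{bmatrix} n \\ \operatorname{comp}(w)\end{bmatrix}_q\right). \]
   Context: A permutation $\sigma \in S_n$ acts on $v \in \mathbb{R}^n$ by $\sigma v = (v_{\sigma^{-1}(1)}, \ldots, v_{\sigma^{-1}(n)})$; $\cdot$ is the standard dot product. A composition of $n$ is a sequence $\alpha=(\alpha_1,\ldots,\alpha_m)$ of positive integers summing to $n$, and $\alpha! := \prod_i \alpha_i!$. For $w \in \mathbb{R}^n$, let $w'$ be its weakly increasing rearrangement; there are unique $0=a_0<a_1<\cdots<a_m=n$ such that $w'$ is constant on each block $\{a_j+1,\ldots,a_{j+1}\}$ and strictly increases between consecutive blocks, and $\operatorname{comp}(w) := (a_1-a_0,\ldots,a_m-a_{m-1})$. The $q$-multinomial coefficient is $\begin{bmatrix} n \\ \alpha\end{bmatrix}_q = \frac{[n]_q!}{[\alpha_1]_q!\cdots[\alpha_m]_q!}$ with $[n]_q = 1+q+\cdots+q^{n-1}$, $[n]_q! = [1]_q\cdots[n]_q$. For a polynomial $f$, $M(f)$ denotes its largest coefficient. *)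

(* Defs.v *)
From HB Require Import structures.
From mathcomp Require Import all_boot all_order all_algebra all_fingroup.
From mathcomp Require Import reals ring.

Set Implicit Arguments.
Unset Strict Implicit.
Unset Printing Implicit Defensive.

Import Order.TTheory GRing.Theory Num.Theory.
Local Open Scope ring_scope.

Definition perm_act (R : realType) (n : nat) (s : 'S_n) (v : 'rV[R]_n) :
  'rV[R]_n := \row_i v 0 ((s^-1)%g i).

Definition dot (R : realType) (n : nat) (u v : 'rV[R]_n) : R :=
  \sum_(i < n) u 0 i * v 0 i.

Definition orth_count (R : realType) (n : nat) (v w : 'rV[R]_n) : nat :=
  #|[set s : 'S_n | dot w (perm_act s v) == 0]|.

Definition increasing_rearrangement (R : realType) (n : nat) (w : 'rV[R]_n) :
  seq R := sort <=%R [seq w 0 i | i <- enum 'I_n].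

(* The block ends a_1 < ... < a_m = n. In the 0-based sequence w' the entries
   of 1-based positions k and k+1 are w'`_k.-1 and w'`_k. *)
Definition block_ends (R : realType) (n : nat) (w : 'rV[R]_n) : seq nat :=
  let w' := increasing_rearrangement w in
  [seq k <- iota 1 n | (k == n) || (w'`_k.-1 < w'`_k)].

(* The differences a_1 - a_0, ..., a_m - a_{m-1} with a_0 = 0. *)
Definition composition_of (R : realType) (n : nat) (w : 'rV[R]_n) : seq nat :=
  pairmap (fun a b => (b - a)%N) 0%N (block_ends w).

Definition comp_fact (alpha : seq nat) : nat := (\prod_(a <- alpha) a`!)%N.

Definition qint (n : nat) : {poly int} := \sum_(i < n) 'X^i.

Definition qfact (n : nat) : {poly int} := \prod_(1 <= i < n.+1) qint i.

(* The divisor is monic, so %/ is genuine Euclidean division over int; it is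
   exact whenever alpha is a composition of n, see qmultinomialK. *)
Definition qmultinomial (n : nat) (alpha : seq nat) : {poly int} :=
  qfact n %/ \prod_(a <- alpha) qfact a.

(* The maximum runs over the coefficients of degrees 0, ..., deg f. *)
Definition max_coef (f : {poly int}) : int :=
  \big[Num.max/f`_0]_(i < size f) f`_i.

Lemma size_increasing_rearrangement (R : realType) (n : nat) (w : 'rV[R]_n) :
  size (increasing_rearrangement w) = n.
Proof. by rewrite size_sort size_map size_enum_ord. Qed.

Lemma increasing_rearrangement_le (R : realType) (n : nat) (w : 'rV[R]_n)
    (i j : nat) : (i <= j)%N -> (j < n)%N ->
  (increasing_rearrangement w)`_i <= (increasing_rearrangement w)`_j.
Proof.
move=> ij jn; apply: (sorted_leq_nth le_trans lexx) => //.
- exact/sort_sorted/le_total.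
- by rewrite inE size_increasing_rearrangement (leq_ltn_trans ij).
- by rewrite inE size_increasing_rearrangement.
Qed.

Lemma block_ends_path (R : realType) (n : nat) (w : 'rV[R]_n) :
  path ltn 0%N (block_ends w).
Proof.
rewrite path_sortedE; last exact: ltn_trans.
rewrite (sorted_filter ltn_trans) ?iota_ltn_sorted // andbT.
by apply/allP => k; rewrite mem_filter mem_iota => /and3P[].
Qed.

Lemma last_block_ends (R : realType) (n : nat) (w : 'rV[R]_n) :
  last 0%N (block_ends w) = n.
Proof.
case: n w => [|m] w //; rewrite /block_ends.
have -> : iota 1 m.+1 = iota 1 m ++ [:: m.+1] by rewrite -{1}(addn1 m) iotaD.
by rewrite filter_cat last_cat /= eqxx.
Qed.

Lemma block_ends_lt (R : realType) (n : nat) (w : 'rV[R]_n) (k : nat) :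
  (0 < k < n)%N -> (k \in block_ends w) =
  ((increasing_rearrangement w)`_k.-1 < (increasing_rearrangement w)`_k).
Proof.
move=> /andP[k0 kn]; rewrite mem_filter mem_iota k0 add1n ltnS (ltnW kn).
by rewrite (ltn_eqF kn) !andbT.
Qed.

Lemma block_ends_const (R : realType) (n : nat) (w : 'rV[R]_n) (k : nat) :
  (0 < k < n)%N -> k \notin block_ends w ->
  (increasing_rearrangement w)`_k.-1 = (increasing_rearrangement w)`_k.
Proof.
move=> k0n; rewrite block_ends_lt // -leNgt => le1.
have /andP[k0 kn] := k0n.
by apply/eqP; rewrite eq_le le1 increasing_rearrangement_le // leq_pred.
Qed.

Lemma composition_of_gt0 (R : realType) (n : nat) (w : 'rV[R]_n) (a : nat) :
  a \in composition_of w -> (0 < a)%N.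
Proof.
suff H s x : path ltn x s ->
    a \in pairmap (fun a b => (b - a)%N) x s -> (0 < a)%N.
  exact: H (block_ends_path w).
elim: s x => //= y s IH x /andP[xy ys].
rewrite inE => /orP[/eqP->|]; first by rewrite subn_gt0.
exact: IH.
Qed.

Lemma sumn_composition_of (R : realType) (n : nat) (w : 'rV[R]_n) :
  sumn (composition_of w) = n.
Proof.
suff H s x : path ltn x s ->
    (x + sumn (pairmap (fun a b => b - a) x s) = last x s)%N.
  by have := H _ _ (block_ends_path w); rewrite add0n last_block_ends.
elim: s x => [|y s IH] x /=; first by rewrite addn0.
by move=> /andP[xy ys]; rewrite addnA subnKC ?(ltnW xy) // IH.
Qed.

Lemma qfact0 : qfact 0 = 1.
Proof. by rewrite /qfact big_geq. Qed.

Lemma qfactS (n : nat) : qfact n.+1 = qfact n * qint n.+1.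
Proof. by rewrite /qfact big_nat_recr. Qed.

Lemma qintD (a b : nat) : qint (a + b) = qint a + 'X^a * qint b.
Proof.
rewrite /qint big_split_ord /= mulr_sumr; congr (_ + _).
by apply: eq_bigr => i _; rewrite exprD.
Qed.

Lemma qfact_monic (n : nat) : qfact n \is monic.
Proof.
elim: n => [|n IH]; first by rewrite qfact0 monic1.
rewrite qfactS monicMl //; apply/monicP; rewrite /qint.
have -> : \sum_(j < n.+1) 'X^j = \poly_(j < n.+1) 1 :> {poly int}.
  by rewrite poly_def; apply: eq_bigr => j _; rewrite scale1r.
by rewrite lead_coef_poly // oner_eq0.
Qed.

Lemma qfactD (a b : nat) : exists g, qfact (a + b) = g * (qfact a * qfact b).
Proof.
have [m] := ubnP (a + b)%N; elim: m a b => // m IH [|a] [|b] abm;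
  try by exists 1; rewrite ?add0n ?addn0 ?qfact0 ?mulr1 ?mul1r.
have [g1 e1] : exists g, qfact (a + b.+1) = g * (qfact a * qfact b.+1).
  by apply: IH; rewrite -ltnS.
have [g2 e2] : exists g, qfact (a.+1 + b) = g * (qfact a.+1 * qfact b).
  by apply: IH; rewrite addSnnS -ltnS.
exists (g1 + 'X^(a.+1) * g2).
have e : qfact (a.+1 + b.+1) =
    qfact (a + b.+1) * qint a.+1 + qfact (a.+1 + b) * ('X^(a.+1) * qint b.+1).
  by rewrite (addSnnS a b) -mulrDr -qintD addSn -qfactS.
by rewrite e e1 e2 !qfactS; ring.
Qed.

Lemma qmultinomialK (n : nat) (alpha : seq nat) : sumn alpha = n ->
  qmultinomial n alpha * \prod_(a <- alpha) qfact a = qfact n.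
Proof.
move=> <-; set P := \prod_(a <- alpha) _.
have Pm : P \is monic by apply: monic_prod => a _; exact: qfact_monic.
have [g e] : exists g, qfact (sumn alpha) = g * P.
  rewrite /P; elim: alpha {P Pm} => [|a s [g IH]].
    by exists 1; rewrite big_nil qfact0 mulr1.
  have [h e] := qfactD a (sumn s); exists (h * g).
  by rewrite big_cons /= e IH; ring.
by rewrite /qmultinomial -/P e Pdiv.IdomainMonic.mulpK.
Qed.

(* Main.v *)
(* A permutation s contributes when the word (w_{s(j)})_j, paired with v sorted
   increasingly, gives 0. Encode a word by the positions of its letters other
   than the smallest one (a 0/1 string) together with the subword of these
   letters, recursively. On 0/1 strings of length n let U be the sum over i of
   sqrt((i+1)(n-1-i)) times the move 10 -> 01 at places i, i+1; on words take
   the tensor sum of these operators. Every move strictly increases the pairing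
   with v and raises the rank (number of inversions) by one, and
   U U^T - U^T U = diag(N - 2 rank), i.e. U and U^T span a representation of
   sl_2. Hence U is injective below the middle rank and U^T above it, so that a
   nonzero maximal minor provides injections of words along moves towards the
   middle rank. Words with the same value of the pairing have different images
   under the iterated injections, and the rank generating function is the
   q-multinomial coefficient. *)
Require Import Defs.
From mathcomp Require Import all_boot all_order all_algebra all_fingroup.
From mathcomp Require Import reals ring lra zify.

Set Implicit Arguments.
Unset Strict Implicit.
Unset Printing Implicit Defensive.

Import Order.TTheory GRing.Theory Num.Theory.
Local Open Scope ring_scope.

(** * Injections from nonzero minors and from a positive commutator *)

Lemma row_free_injection (F : fieldType) (m k : nat) (A : 'M[F]_(m, k)) :
  row_free A ->
  exists2 f : 'I_m -> 'I_k, injective f & forall i, A i (f i) != 0.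
Proof.
move=> freeA; have fullAT : row_full A^T by rewrite -col_leq_rank mxrank_tr row_leq_rank.
pose g := fullrankfun fullAT.
have : \det (rowsub g A^T) != 0.
  by rewrite -unitfE -unitmxE -row_full_unit; apply: fullrowsub_full.
(* Some term of the Leibniz expansion of this maximal minor is nonzero, and its permutation matches
   the rows of [A] with the columns chosen by [g]. *)
rewrite /determinant => /eqP det0.
have [s /prodf_neq0 s0] : exists s : 'S_m, \prod_i (rowsub g A^T) i (s i) != 0.
  apply/existsP; apply: contra_notT det0 => /existsPn s0.
  by apply: big1 => s _; have /negPn/eqP -> := s0 s; rewrite mulr0.
exists (fun i => g ((s^-1)%g i)).
  by move=> i j /fullrankfun_inj /perm_inj.
by move=> i; have := s0 ((s^-1)%g i) isT; rewrite !mxE permKV.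
Qed.

Section Commutator.
Variables (R : realFieldType) (P : finType) (U : P -> P -> R) (h : P -> R).
Hypothesis commU : forall x y,
  \sum_z U x z * U y z - \sum_z U z x * U z y = (x == y)%:R * h x.

(* [|f U|^2 = |f U^T|^2 + \sum_x h x f x^2]. *)
Lemma weight_pos_injective (f : P -> R) :
  (forall x, f x != 0 -> 0 < h x) ->
  (forall z, \sum_x f x * U x z = 0) -> forall x, f x = 0.
Proof.
move=> hpos fU0.
have sq (V : P -> P -> R) : \sum_z (\sum_x f x * V x z) ^+ 2 =
    \sum_x \sum_y f x * f y * \sum_z V x z * V y z.
  under eq_bigr => z _.
    rewrite expr2 big_distrl /=.
    under eq_bigr => x _ do rewrite big_distrr /=.
    over.
  rewrite exchange_big /=; apply: eq_bigr => x _.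
  rewrite exchange_big /=; apply: eq_bigr => y _.
  by rewrite big_distrr /=; apply: eq_bigr => z _; ring.
have key : \sum_z (\sum_x f x * U x z) ^+ 2 =
    \sum_z (\sum_x f x * U z x) ^+ 2 + \sum_x h x * f x ^+ 2.
  rewrite (sq U) (sq (fun x z => U z x)) -big_split /=.
  apply: eq_bigr => x _.
  have -> : h x * f x ^+ 2 = \sum_y f x * f y * ((x == y)%:R * h x).
    rewrite (bigD1 x) //= eqxx big1 => [|y].
      by rewrite addr0 mul1r mulrC expr2.
    by rewrite eq_sym => /negPf->; rewrite mul0r mulr0.
  rewrite -big_split /=; apply: eq_bigr => y _.
  by rewrite -commU; ring.
have term_ge0 x : 0 <= h x * f x ^+ 2.
  have [->|f0] := eqVneq (f x) 0; first by rewrite expr0n mulr0.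
  by rewrite mulr_ge0 ?sqr_ge0 // ltW // hpos.
have sum0 : \sum_x h x * f x ^+ 2 = 0.
  have := key; rewrite big1 => [e|z _]; last by rewrite fU0 expr0n.
  have ge0 : 0 <= \sum_z (\sum_x f x * U z x) ^+ 2.
    by apply: sumr_ge0 => z _; apply: sqr_ge0.
  have ge0' : 0 <= \sum_x h x * f x ^+ 2 by apply: sumr_ge0.
  lra.
move=> x; apply/eqP/negPn/negP => f0.
have := psumr_eq0P (fun i _ => term_ge0 i) sum0 (i := x) isT.
by apply/eqP; rewrite mulf_neq0 ?expf_neq0 // gt_eqF // hpos.
Qed.

(** A left kernel vector of the rows of [U] indexed by [A], extended by zero, is killed by [U] and
    supported where [h] is positive, so it vanishes: these rows are independent. *)
Lemma weight_pos_matching (A : {set P}) : (forall x, x \in A -> 0 < h x) ->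
  exists2 f : P -> P, {in A &, injective f} & {in A, forall x, U x (f x) != 0}.
Proof.
move=> hpos.
have [->|[x0 Ax0]] := set_0Vmem A.
  by exists id => x; rewrite inE.
pose M : 'M[R]_(#|A|, #|P|) := \matrix_(i, j) U (enum_val i) (enum_val j).
have freeM : row_free M.
  rewrite -kermx_eq0; apply/rowV0P => u /sub_kermxP uM.
  pose f x := if x \in A then u 0 (enum_rank_in Ax0 x) else 0.
  suff f0 x : f x = 0.
    apply/rowP => i; rewrite mxE -[RHS](f0 (enum_val i)) /f enum_valP.
    by rewrite enum_valK_in.
  apply: (@weight_pos_injective f) => {x} [x|z].
    by rewrite /f; case: ifP => [/hpos|]; rewrite ?eqxx.
  have /rowP/(_ (enum_rank z)) := uM; rewrite !mxE => uz; rewrite -[RHS]uz.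
  rewrite (bigID (mem A)) /= addrC big1 ?add0r; last first.
    by move=> x /negPf Ax; rewrite /f Ax mul0r.
  rewrite (reindex_onto enum_val (enum_rank_in Ax0)) /=; last first.
    by move=> x Ax; rewrite enum_rankK_in.
  apply: eq_big => [i|i _]; first by rewrite enum_valP enum_valK_in eqxx.
  by rewrite /f enum_valP enum_valK_in mxE enum_rankK.
have [g ginj gU] := row_free_injection freeM.
exists (fun x => enum_val (g (enum_rank_in Ax0 x))).
  move=> x y Ax Ay /enum_val_inj/ginj e.
  by rewrite -(enum_rankK_in Ax0 Ax) e enum_rankK_in.
move=> x Ax; have := gU (enum_rank_in Ax0 x).
by rewrite mxE enum_rankK_in.
Qed.

End Commutator.

(** * Injections iterated towards the middle rank *)

Section Descent.
Variables (R : realFieldType) (P : finType) (D : pred P) (d : P -> nat).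
Variables (F : P -> P) (phi : P -> R).
Hypothesis FD : forall x, D x -> (0 < d x)%N ->
  [/\ D (F x), d x = (d (F x)).+1 & phi x < phi (F x)].
Hypothesis Finj : {in [pred x | D x & (0 < d x)%N] &, injective F}.

Lemma descent_iter k x : D x -> (k <= d x)%N ->
  [/\ D (iter k F x), d x = (d (iter k F x) + k)%N &
      if k is 0 then phi x = phi (iter k F x) else phi x < phi (iter k F x)].
Proof.
move=> Dx; elim: k => [|k IH] kd; first by rewrite addn0.
have [Dk dk pk] := IH (ltnW kd).
have [|DF dF pF] := FD Dk; first by lia.
split=> //=; first lia.
case: k {IH kd dk dF Dk DF} pk pF => [|k] //= pk pF.
exact: lt_trans pk pF.
Qed.

(** Cancelling the injective steps backwards from the common end shows that the shorter chain is a
    tail of the longer one. *)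
Lemma descent_end_eq x y : D x -> D y -> (d x <= d y)%N ->
  iter (d x) F x = iter (d y) F y -> x = iter (d y - d x) F y.
Proof.
move=> Dx Dy; move dxk : (d x) => k.
elim: k x Dx dxk => [|k IH] x Dx dxk kd; first by rewrite subn0.
rewrite iterSr => e.
have [|DF dF _] := FD Dx; first lia.
have eF := IH (F x) DF ltac:(lia) ltac:(lia) e.
have [Dz dz _] := descent_iter Dy (k := (d y - k.+1)%N) ltac:(lia).
apply: Finj; rewrite ?inE ?Dx ?Dz ?dxk //=; first lia.
by rewrite eF -iterS subnSK.
Qed.

(** If the starting points differed, one would lie strictly further along the chain of the other,
    where [phi] is strictly larger. *)
Lemma descent_end_inj x y : D x -> D y -> phi x = phi y ->
  iter (d x) F x = iter (d y) F y -> x = y.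
Proof.
move=> Dx Dy pxy e; wlog lexy : x y Dx Dy pxy e / (d x <= d y)%N.
  move=> H; have [/H|/ltnW/H H'] := leqP (d x) (d y); first exact.
  by symmetry; apply: H'.
have exy := descent_end_eq Dx Dy lexy e.
have [_ _] := descent_iter Dy (leq_subr (d x) (d y)).
rewrite -exy; case: (d y - d x)%N exy => [|k] // _.
by rewrite pxy ltxx.
Qed.

End Descent.

Section Sperner.
Variables (R : realFieldType) (P : finType) (U : P -> P -> R).
Variables (D : pred P) (r : P -> nat) (h phi : P -> R) (N : nat).
Hypothesis commU : forall x y,
  \sum_z U x z * U y z - \sum_z U z x * U z y = (x == y)%:R * h x.
Hypothesis hE : forall x, D x -> h x = N%:R - 2 * (r x)%:R.
Hypothesis UD : forall x y, U x y != 0 -> D x = D y.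
Hypothesis Ur : forall x y, U x y != 0 -> D x ->
  r y = (r x).+1 /\ phi x < phi y.

(** [h] is positive below rank [m] and negative above it, so [U] gives an injection [F] upwards from
    the ranks below [m], and its transpose an injection [G] downwards from those above. Iterating
    them sends a level set of [phi] injectively into rank [m]. *)
Lemma level_set_le_middle_rank (t : R) :
  (#|[set x | D x & phi x == t]| <= #|[set x | D x & r x == N./2]|)%N.
Proof.
set m := N./2.
have mN : (m.*2 <= N < m.*2.+2)%N by rewrite /m; lia.
clearbody m.
have [F Finj FU] := weight_pos_matching commU
    (A := [set x | D x & (r x < m)%N]) ltac:(by move=> x; rewrite inE =>
      /andP[Dx rm]; rewrite hE // subr_gt0 -natrM ltr_nat; lia).
have commUT x y : \sum_z U z x * U z y - \sum_z U x z * U y z =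
    (x == y)%:R * - h x by rewrite mulrN -commU opprB.
have [G Ginj GU] := weight_pos_matching (U := fun x y => U y x) commUT
    (A := [set x | D x & (m < r x)%N]) ltac:(by move=> x; rewrite inE =>
      /andP[Dx rm]; rewrite hE // opprB subr_gt0 -natrM ltr_nat; lia).
pose DF := [pred x | D x & (r x <= m)%N]; pose DG := [pred x | D x & (m <= r x)%N].
have FD x : DF x -> (0 < m - r x)%N ->
    [/\ DF (F x), (m - r x = (m - r (F x)).+1)%N & phi x < phi (F x)].
  move=> /andP[Dx rx] dx.
  have Ux : U x (F x) != 0 by apply: FU; rewrite inE Dx; lia.
  have [rF pF] := Ur Ux Dx.
  by split; rewrite /= -?(UD Ux) ?Dx ?rF //; lia.
(* [G] lowers [phi], so the descent lemmas are applied to the opposite of [phi]. *)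
have GD x : DG x -> (0 < r x - m)%N ->
    [/\ DG (G x), (r x - m = (r (G x) - m).+1)%N & - phi x < - phi (G x)].
  move=> /andP[Dx rx] dx.
  have Ux : U (G x) x != 0 by apply: GU; rewrite inE Dx; lia.
  have DGx : D (G x) by rewrite (UD Ux).
  have [rF pF] := Ur Ux DGx.
  by split; rewrite /= ?DGx ?ltrN2 //; lia.
have FDinj : {in [pred x | DF x & (0 < m - r x)%N] &, injective F}.
  by move=> x y; rewrite !inE => /andP[/andP[Dx ?] ?] /andP[/andP[Dy ?] ?];
     apply: Finj; rewrite inE ?Dx ?Dy /=; lia.
have GDinj : {in [pred x | DG x & (0 < r x - m)%N] &, injective G}.
  by move=> x y; rewrite !inE => /andP[/andP[Dx ?] ?] /andP[/andP[Dy ?] ?];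
     apply: Ginj; rewrite inE ?Dx ?Dy /=; lia.
pose K x := if (r x <= m)%N then iter (m - r x) F x else iter (r x - m) G x.
have Kinj : {in [set x | D x & phi x == t] &, injective K}.
  (* An upward chain never decreases [phi] and a nonempty downward chain strictly decreases it, so
     from equal values of [phi] they cannot end at the same point. *)
  have mixed x y : D x -> D y -> phi x = phi y -> (r x <= m)%N -> (m < r y)%N ->
      iter (m - r x) F x = iter (r y - m) G y -> False.
    move=> Dx Dy pxy rx ry e.
    have [||_ _ pF] := descent_iter FD (k := (m - r x)%N) (x := x) => //.
      by rewrite /= Dx.
    have [||_ _] := descent_iter GD (k := (r y - m)%N) (x := y) => //.
      by rewrite /= Dy ltnW.
    rewrite -e; case: (r y - m)%N (subn_gt0 m (r y)); rewrite ry // => k _.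
    rewrite ltrN2 -pxy => pG.
    by case: (m - r x)%N pF pG => [<-|k' /lt_trans H /H]; rewrite ltxx.
  move=> x y; rewrite !inE => /andP[Dx /eqP px] /andP[Dy /eqP py].
  have pxy : phi x = phi y by rewrite px.
  rewrite /K; have [rx|rx] := leqP (r x) m; have [ry|ry] := leqP (r y) m.
  - by apply: (descent_end_inj FD FDinj); rewrite //= ?Dx ?Dy.
  - by move/(mixed x y Dx Dy pxy rx ry).
  - by move=> e; case: (mixed y x Dy Dx (esym pxy) ry rx (esym e)).
  - apply: (descent_end_inj GD GDinj); rewrite /= ?Dx ?Dy ?pxy //; exact: ltnW.
rewrite -(card_in_imset Kinj); apply: subset_leq_card.
apply/subsetP => z /imsetP[x]; rewrite !inE => /andP[Dx _] ->.
rewrite /K; case: leqP => rx.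
  have [||/andP[DK rK] dK _] := descent_iter FD (k := (m - r x)%N) (x := x) => //.
    by rewrite /= Dx.
  by rewrite DK; lia.
have [||/andP[DK rK] dK _] := descent_iter GD (k := (r x - m)%N) (x := x) => //.
  by rewrite /= Dx ltnW.
by rewrite DK; lia.
Qed.

End Sperner.

(** * Moves on 0/1 strings and their sl_2 operator *)

Definition swap_at (T : Type) (x0 : T) (i : nat) (s : seq T) : seq T :=
  take i s ++ nth x0 s i.+1 :: nth x0 s i :: drop i.+2 s.

Lemma size_swap_at (T : Type) (x0 : T) (i : nat) (s : seq T) :
  (i.+1 < size s)%N -> size (swap_at x0 i s) = size s.
Proof. by move=> lti; rewrite size_cat /= size_takel ?size_drop; lia. Qed.

Lemma nth_swap_at (T : Type) (x0 : T) (i k : nat) (s : seq T) :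
  (i.+1 < size s)%N ->
  nth x0 (swap_at x0 i s) k =
  nth x0 s (if k == i then i.+1 else if k == i.+1 then i else k).
Proof.
move=> lti; rewrite nth_cat size_takel; last lia.
case: (ltngtP k i) => [ki|ik|->]; last by rewrite subnn.
  by rewrite nth_take // ifN //; lia.
have [->|nk] := eqVneq k i.+1; first by rewrite subSnn.
have [j ->] : exists j, k = (j + i.+2)%N by exists (k - i.+2)%N; lia.
by rewrite (_ : j + i.+2 - i = j.+2)%N /= ?nth_drop 1?addnC //; lia.
Qed.

(** An inversion is here a [false] before a [true], so that the move 10 -> 01 adds one. *)
Fixpoint inversions (s : seq bool) : nat :=
  if s is b :: s' then ((if b then 0 else count id s') + inversions s')%N
  else 0.

Definition raisable (i : nat) (s : seq bool) : bool :=
  nth false s i && ~~ nth false s i.+1.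

Definition lowerable (i : nat) (s : seq bool) : bool :=
  ~~ nth false s i && nth false s i.+1.

Lemma raisableP (i : nat) (s : seq bool) : (i.+1 < size s)%N -> raisable i s ->
  s = take i s ++ true :: false :: drop i.+2 s /\
  swap_at false i s = take i s ++ false :: true :: drop i.+2 s.
Proof.
move=> lti /andP[si /negPf si1]; rewrite /swap_at si si1; split=> //.
by rewrite -{1}(cat_take_drop i s) (drop_nth false) 1?(drop_nth false (n := i.+1)) ?si ?si1 //; lia.
Qed.

Lemma count_raise (A B : seq bool) :
  count id (A ++ false :: true :: B) = count id (A ++ true :: false :: B).
Proof. by rewrite !count_cat. Qed.

Lemma inversions_raise (A B : seq bool) :
  inversions (A ++ false :: true :: B) = (inversions (A ++ true :: false :: B)).+1.
Proof. by elim: A => [|b A IH] /=; rewrite ?IH ?count_raise; lia. Qed.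

Section BitOperator.
Variables (R : rcfType) (n : nat).
Implicit Types S T : n.-tuple bool.

(** Matrix coefficients of the n-dimensional irreducible representation of sl_2 in an orthonormal
    weight basis; the square roots are why the field is real closed. The value at i = n - 1 is
    zero. *)
Definition bit_coef (i : nat) : R := Num.sqrt (i.+1%:R * (n%:R - i.+1%:R)).

Lemma sqr_bit_coef (i : 'I_n) : bit_coef i ^+ 2 = i.+1%:R * (n%:R - i.+1%:R).
Proof. by rewrite sqr_sqrtr // mulr_ge0 // subr_ge0 ler_nat. Qed.

Definition bit_step (i : nat) S T : bool :=
  [&& (i.+1 < n)%N, raisable i S & val T == swap_at false i S].

Definition bit_up S T : R := \sum_(i < n) bit_coef i * (bit_step i S T)%:R.

(** The weight of [S] in the exterior algebra of that representation, whose basis vector at place i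
    has weight n - 1 - 2i. *)
Definition bit_weight S : R :=
  \sum_(i < n) (nth false S i)%:R * (n%:R - 1 - 2 * i%:R).

Lemma bit_stepP (i : nat) S T : (i.+1 < n)%N -> reflect
  [/\ raisable i S, lowerable i T &
    forall k, k != i -> k != i.+1 -> nth false S k = nth false T k]
  (bit_step i S T).
Proof.
move=> lti; rewrite /bit_step lti /=; apply: (iffP andP) => [[aS /eqP eT]|].
  split=> // [|k /negPf ki /negPf ki1].
    rewrite /lowerable eT !nth_swap_at ?size_tuple // eqxx.
    by rewrite ifN ?eqxx; [rewrite andbC|lia].
  by rewrite eT nth_swap_at ?size_tuple // ki ki1.
case=> aS dT ST; split=> //; apply/eqP/(@eq_from_nth _ false).
  by rewrite size_swap_at ?size_tuple.
move=> k _; rewrite nth_swap_at ?size_tuple //.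
move: aS dT => /andP[Si /negPf Si1] /andP[/negPf Ti Ti1].
have [->|ki] := eqVneq k i; first by rewrite Si1 Ti.
by have [->|ki1] := eqVneq k i.+1; rewrite ?Si ?Ti1 ?ST.
Qed.

Definition bit_swap (i : nat) S : n.-tuple bool := insubd S (swap_at false i S).

Lemma val_bit_swap (i : nat) S : (i.+1 < n)%N ->
  val (bit_swap i S) = swap_at false i S.
Proof. by move=> lti; rewrite val_insubd size_swap_at ?size_tuple // eqxx. Qed.

Lemma nth_bit_swap (i k : nat) S : (i.+1 < n)%N -> nth false (bit_swap i S) k =
  nth false S (if k == i then i.+1 else if k == i.+1 then i else k).
Proof. by move=> lti; rewrite val_bit_swap // nth_swap_at ?size_tuple. Qed.

Lemma nth_bit_swap_id (i k : nat) S : (i.+1 < n)%N -> k != i -> k != i.+1 ->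
  nth false (bit_swap i S) k = nth false S k.
Proof. by move=> lti /negPf ki /negPf ki1; rewrite nth_bit_swap // ki ki1. Qed.

Lemma nth_bit_swap0 (i : nat) S : (i.+1 < n)%N ->
  nth false (bit_swap i S) i = nth false S i.+1.
Proof. by move=> lti; rewrite nth_bit_swap // eqxx. Qed.

Lemma nth_bit_swap1 (i : nat) S : (i.+1 < n)%N ->
  nth false (bit_swap i S) i.+1 = nth false S i.
Proof. by move=> lti; rewrite nth_bit_swap // eqxx ifN //; lia. Qed.

Lemma bit_stepE (i : nat) S T :
  bit_step i S T = [&& (i.+1 < n)%N, raisable i S & T == bit_swap i S].
Proof.
rewrite /bit_step; case: ltnP => //= lti; congr (_ && _).
by rewrite -(inj_eq val_inj) val_bit_swap.
Qed.

Lemma bit_swapK (i : nat) : (i.+1 < n)%N -> involutive (bit_swap i).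
Proof.
move=> lti S; apply/val_inj/(@eq_from_nth _ false); rewrite ?size_tuple //.
move=> k _; rewrite !nth_bit_swap //; congr nth.
have [->|ki] := eqVneq k i; first by rewrite eqxx ifN //; lia.
have [->|ki1] := eqVneq k i.+1; first by rewrite eqxx.
by rewrite (negPf ki) (negPf ki1).
Qed.

Lemma raisable_bit_swap (i : nat) S : (i.+1 < n)%N ->
  raisable i (bit_swap i S) = lowerable i S.
Proof.
by move=> lti; rewrite /raisable nth_bit_swap0 // nth_bit_swap1 // andbC.
Qed.

Lemma bit_stepVE (i : nat) S T :
  bit_step i T S = [&& (i.+1 < n)%N, lowerable i S & T == bit_swap i S].
Proof.
rewrite bit_stepE; case: ltnP => //= lti.
have -> : (S == bit_swap i T) = (T == bit_swap i S).
  by rewrite eq_sym (can2_eq (bit_swapK lti) (bit_swapK lti)).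
by case: eqP => [->|]; rewrite ?andbF // raisable_bit_swap.
Qed.

(* Two different moves into the same tuple happen at disjoint places, hence
   commute. *)
Lemma bit_step_diamond (i j : nat) S S' T : i != j ->
  bit_step i S T -> bit_step j S' T ->
  exists2 T', bit_step i T' S' & bit_step j T' S.
Proof.
move=> nij; have [lti|] := boolP (i.+1 < n)%N; last by rewrite /bit_step => /negPf->.
have [ltj|] := boolP (j.+1 < n)%N; last by rewrite /bit_step => /negPf->.
move=> /(bit_stepP _ _ lti)[/andP[Si Si1] /andP[Ti Ti1] eST].
move=> /(bit_stepP _ _ ltj)[/andP[S'j S'j1] /andP[Tj Tj1] eS'T].
have nij1 : i != j.+1 by apply: contraNneq Ti => ->.
have ni1j : j != i.+1 by apply: contraNneq Tj => ->.
exists (bit_swap j S).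
  apply/bit_stepP => //; split.
  - by rewrite /raisable !nth_bit_swap_id ?Si ?Si1 //; lia.
  - by rewrite /lowerable !eS'T ?Ti ?Ti1 //; lia.
  move=> k ki ki1; rewrite nth_bit_swap //.
  have [->|kj] := eqVneq k j; first by rewrite eST ?S'j //; lia.
  have [->|kj1] := eqVneq k j.+1.
    by rewrite eST ?(negPf Tj) ?(negPf S'j1) //; lia.
  by rewrite eS'T ?eST.
apply/bit_stepP => //; split.
- by rewrite /raisable nth_bit_swap0 // nth_bit_swap1 // !eST ?Tj1 ?Tj //; lia.
- by rewrite /lowerable !eST ?Tj ?Tj1 //; lia.
- by move=> k kj kj1; rewrite nth_bit_swap_id.
Qed.

(** Different moves out of one tuple cannot overlap either: a common place would carry 1 for one
    move and 0 for the other. *)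
Lemma bit_step_diamondV (i j : nat) S S' T : i != j ->
  bit_step i T S -> bit_step j T S' ->
  exists2 T', bit_step i S' T' & bit_step j S T'.
Proof.
move=> nij; have [lti|] := boolP (i.+1 < n)%N; last by rewrite /bit_step => /negPf->.
have [ltj|] := boolP (j.+1 < n)%N; last by rewrite /bit_step => /negPf->.
move=> /(bit_stepP _ _ lti)[/andP[Ti Ti1] /andP[Si Si1] eTS].
move=> /(bit_stepP _ _ ltj)[/andP[Tj Tj1] /andP[S'j S'j1] eTS'].
have nij1 : i != j.+1 by apply: contraNneq Tj1 => <-.
have ni1j : j != i.+1 by apply: contraNneq Ti1 => <-.
exists (bit_swap j S).
  apply/bit_stepP => //; split.
  - by rewrite /raisable -!eTS' ?Ti ?Ti1 //; lia.
  - by rewrite /lowerable !nth_bit_swap_id ?Si ?Si1 //; lia.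
  move=> k ki ki1; rewrite nth_bit_swap //.
  have [->|kj] := eqVneq k j.
    by rewrite -eTS ?(negPf Tj1) ?(negPf S'j) //; lia.
  have [->|kj1] := eqVneq k j.+1.
    by rewrite -eTS ?S'j1 //; lia.
  by rewrite -eTS' ?eTS.
apply/bit_stepP => //; split.
- by rewrite /raisable -!eTS ?Tj ?Tj1 //; lia.
- by rewrite /lowerable nth_bit_swap0 // nth_bit_swap1 // -!eTS ?Tj1 ?Tj //; lia.
- by move=> k kj kj1; rewrite nth_bit_swap_id.
Qed.

(** The place and the source determine the target of a move, so at most one term is nonzero. *)
Lemma sum_bit_step (i j : nat) S S' :
  \sum_T (bit_step i S T)%:R * (bit_step j S' T)%:R =
  [exists T, bit_step i S T && bit_step j S' T]%:R :> R.
Proof.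
case: (boolP [exists T, _]) => [/existsP[T /andP[ST S'T]]|/existsPn noT].
  rewrite (bigD1 T) //= ST S'T mulr1 big1 ?addr0 // => T' nT.
  move: ST nT; rewrite !bit_stepE => /and3P[_ _ /eqP->] /negPf->.
  by rewrite !andbF mul0r.
by apply: big1 => T _; have := noT T; do 2![case: bit_step] => //; rewrite ?mul0r ?mulr0.
Qed.

Lemma sum_bit_stepV (i j : nat) S S' :
  \sum_T (bit_step i T S)%:R * (bit_step j T S')%:R =
  [exists T, bit_step i T S && bit_step j T S']%:R :> R.
Proof.
case: (boolP [exists T, _]) => [/existsP[T /andP[ST S'T]]|/existsPn noT].
  rewrite (bigD1 T) //= ST S'T mulr1 big1 ?addr0 // => T' nT.
  move: ST nT; rewrite !bit_stepVE => /and3P[_ _ /eqP->] /negPf->.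
  by rewrite !andbF mul0r.
by apply: big1 => T _; have := noT T; do 2![case: bit_step] => //; rewrite ?mul0r ?mulr0.
Qed.

Lemma sum_bit_up2 (step : nat -> n.-tuple bool -> n.-tuple bool -> bool) S S' :
  \sum_T (\sum_(i < n) bit_coef i * (step i S T)%:R) *
         (\sum_(i < n) bit_coef i * (step i S' T)%:R) =
  \sum_(i < n) \sum_(j < n) bit_coef i * bit_coef j *
    \sum_T (step i S T)%:R * (step j S' T)%:R.
Proof.
under eq_bigr => T _.
  rewrite big_distrl /=.
  under eq_bigr => i _ do rewrite big_distrr /=.
  over.
rewrite exchange_big /=; apply: eq_bigr => i _.
rewrite exchange_big /=; apply: eq_bigr => j _.
by rewrite big_distrr /=; apply: eq_bigr => T _; rewrite mulrACA.
Qed.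

(** Summation by parts, since (i+1)(a-i-1) - i(a-i) = a - 1 - 2i. The boundary term vanishes for a =
    m. *)
Lemma abel_sum_weight (a : R) (f : nat -> R) (m : nat) :
  \sum_(i < m) i.+1%:R * (a - i.+1%:R) * (f i - f i.+1) =
  \sum_(i < m) f i * (a - 1 - 2 * i%:R) - m%:R * (a - m%:R) * f m.
Proof.
elim: m => [|m IH]; first by rewrite !big_ord0 mul0r mul0r subr0.
by rewrite !big_ord_recr /= IH -!natr1; ring.
Qed.

(** Pairs of moves at different places cancel by the diamonds. Place i alone contributes its squared
    coefficient times the difference of the bits at i and i+1, and summation by parts yields the
    weight. *)
Lemma bit_up_comm S S' :
  \sum_T bit_up S T * bit_up S' T - \sum_T bit_up T S * bit_up T S' =
  (S == S')%:R * bit_weight S.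
Proof.
rewrite sum_bit_up2 (sum_bit_up2 (fun i S T => bit_step i T S)).
(* The places are exchanged in the second sum because a diamond completes the move i out of [S] by a
   move i into [S']. *)
rewrite [X in _ - X]exchange_big -sumrB /=.
transitivity (\sum_(i < n) bit_coef i ^+ 2 *
    ((S == S')%:R * ((nth false S i)%:R - (nth false S i.+1)%:R))).
  apply: eq_bigr => i _; rewrite -sumrB (bigD1 i) //= [X in _ + X]big1 => [|j].
    rewrite addr0 sum_bit_step sum_bit_stepV -mulrBr expr2.
    (* At the last place there is no move, and the coefficient is zero. *)
    have [lti|] := ltnP i.+1 n; last first.
      move=> leni; have -> : bit_coef i = 0; last by rewrite !mul0r.
      have e : i.+1 = n by apply/eqP; rewrite eqn_leq ltn_ord.
      by rewrite /bit_coef e subrr mulr0 sqrtr0.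
    congr (_ * _).
    have -> : [exists T, bit_step i S T && bit_step i S' T] =
        (S == S') && raisable i S.
      apply/existsP/andP => [[T]|[/eqP<- aS]].
        rewrite !bit_stepE lti /= => /andP[/andP[-> /eqP->]].
        by case/andP => _ /eqP/(can_inj (bit_swapK lti))->.
      by exists (bit_swap i S); rewrite !bit_stepE lti aS eqxx.
    have -> : [exists T, bit_step i T S && bit_step i T S'] =
        (S == S') && lowerable i S.
      apply/existsP/andP => [[T]|[/eqP<- aS]].
        rewrite !bit_stepVE lti /= => /andP[/andP[-> /eqP->]].
        by case/andP => _ /eqP/(can_inj (bit_swapK lti))->.
      by exists (bit_swap i S); rewrite !bit_stepVE lti aS eqxx.
    rewrite /raisable /lowerable.
    by do 2!case: (nth _ _ _); case: (S == S') => /=; ring.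
  rewrite eq_sym => nij; rewrite sum_bit_step sum_bit_stepV.
  rewrite [bit_coef j * _]mulrC -mulrBr.
  set b := [exists T, _]; set b' := [exists T, _].
  suff -> : b = b' by rewrite subrr mulr0.
  apply/existsP/existsP => [[T /andP[ST S'T]]|[T /andP[ST S'T]]].
    by have [T' ? ?] := bit_step_diamond nij ST S'T; exists T'; apply/andP.
  rewrite eq_sym in nij.
  by have [T' ? ?] := bit_step_diamondV nij ST S'T; exists T'; apply/andP.
under eq_bigr => i _ do rewrite sqr_bit_coef mulrCA.
rewrite -mulr_sumr; congr (_ * _).
rewrite (abel_sum_weight _ (fun i => (nth false S i)%:R)) subrr mulr0 mul0r.
by rewrite subr0.
Qed.

(** The parameter [a] is free because removing the first letter replaces it by a - 2. For a equal to
    the length n and b ones, the weight is b(n-b) minus twice the rank. *)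
Lemma sum_nth_weight (s : seq bool) (a : R) :
  \sum_(i < size s) (nth false s i)%:R * (a - 1 - 2 * i%:R) =
  (count id s)%:R * (a - (count id s)%:R) - 2 * (inversions s)%:R.
Proof.
elim: s a => [|b s IH] a; first by rewrite big_ord0 /=; ring.
rewrite /= big_ord_recl /=.
under eq_bigr => i _.
  rewrite /bump /= add1n -[i.+1%:R]natr1.
  have -> : a - 1 - 2 * (i%:R + 1) = (a - 2) - 1 - 2 * i%:R :> R by ring.
  over.
by rewrite IH; case: b; rewrite /= ?add0n ?natrD ?add1n -?natr1; ring.
Qed.

Lemma bit_weightE S : bit_weight S =
  (count id S)%:R * (n%:R - (count id S)%:R) - 2 * (inversions S)%:R.
Proof. by rewrite -sum_nth_weight size_tuple. Qed.

Lemma bit_up_neq0 S T : bit_up S T != 0 -> exists A B,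
  val S = A ++ true :: false :: B /\ val T = A ++ false :: true :: B.
Proof.
have [/existsP[i /and3P[lti aS /eqP eT]] _|/existsPn noi] :=
    boolP [exists i : 'I_n, bit_step i S T].
  have [|e1 e2] := raisableP _ aS; first by rewrite size_tuple.
  by exists (take i S), (drop i.+2 S); rewrite eT e2.
rewrite /bit_up big1 ?eqxx // => i _.
by rewrite (negPf (noi i)) mulr0.
Qed.

End BitOperator.

(** * Gaussian binomial coefficients as generating functions of inversions *)

Lemma big_tuple_bool (V : nmodType) (n : nat) (p : pred (seq bool))
    (f : seq bool -> V) :
  \sum_(S : n.+1.-tuple bool | p S) f S =
  \sum_(S : n.-tuple bool | p (true :: S)) f (true :: S) +
  \sum_(S : n.-tuple bool | p (false :: S)) f (false :: S).
Proof.
rewrite (reindex (fun x : bool * n.-tuple bool => [tuple of x.1 :: x.2])) /=.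
  rewrite big_mkcond -(pair_bigA _ (fun b (S : n.-tuple bool) =>
    if p (b :: S) then f (b :: S) else 0)) /=.
  by rewrite big_bool -!big_mkcond.
exists (fun S : n.+1.-tuple bool => (thead S, [tuple of behead S])) => [[b S] _|S _] /=.
  by congr pair; apply: val_inj.
by rewrite -tuple_eta.
Qed.

Definition qbinomial_sum (n b : nat) : {poly int} :=
  \sum_(S : n.-tuple bool | count id S == b) 'X^(inversions S).

(** The q-Pascal rule, by the first letter: a leading 0 precedes all b ones and contributes b
    inversions. *)
Lemma qbinomial_sumS (n b : nat) : qbinomial_sum n.+1 b =
  (if b is b'.+1 then qbinomial_sum n b' else 0) + 'X^b * qbinomial_sum n b.
Proof.
rewrite /qbinomial_sum (big_tuple_bool n (fun s => count id s == b)
  (fun s => 'X^(inversions s))) /=; congr (_ + _).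
  by case: b => [|b]; [rewrite big_pred0|apply: eq_bigl].
rewrite mulr_sumr; apply: eq_bigr => S /eqP <-.
by rewrite exprD.
Qed.

Lemma qbinomial_sum_small (n b : nat) : (n < b)%N -> qbinomial_sum n b = 0.
Proof.
move=> ltnb; apply: big_pred0 => S; apply/eqP => e.
by have := count_size id S; rewrite e size_tuple leqNgt ltnb.
Qed.

(** Both sides satisfy the same recursion: q-Pascal on the left, [b+a] = [b] + q^b [a] on the
    right. *)
Lemma qbinomial_sumP (a b : nat) :
  qbinomial_sum (a + b) b * (qfact a * qfact b) = qfact (a + b).
Proof.
move eqn : (a + b)%N => n; elim: n a b eqn => [|n IH] a b eqn.
  have [-> ->] : a = 0%N /\ b = 0%N by lia.
  rewrite qfact0 !mulr1 /qbinomial_sum (eq_bigr (fun=> 1)) => [|S]; last first.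
    by rewrite tuple0 /= expr0.
  rewrite (eq_bigl xpredT) => [|S]; last by rewrite tuple0.
  by rewrite sumr_const card_tuple expn0.
rewrite qbinomial_sumS.
case: b eqn => [|b] eqn.
  have -> : a = n.+1 by lia.
  have := IH n 0%N (addn0 n); rewrite qfact0 qfactS expr0 => e.
  by rewrite -[in RHS]e; ring.
rewrite (_ : n.+1 = (b.+1 + a)%N); last lia.
rewrite mulrDl {1}qfactS (mulrA (qfact a)) mulrA IH; last lia.
case: a eqn => [|a] eqn.
  rewrite qbinomial_sum_small; last lia.
  by rewrite mulr0 mul0r addr0 addn0 qfactS (_ : n = b) //; lia.
have -> : qfact (b.+1 + a.+1) = qfact n * (qint b.+1 + 'X^(b.+1) * qint a.+1).
  by rewrite -qintD (_ : n = b.+1 + a)%N ?addnS ?qfactS //; lia.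
rewrite mulrDr; congr (_ + _).
by rewrite -[in RHS](IH a b.+1) ?qfactS; [ring|lia].
Qed.

(** * Tensor sums of operators *)

Section TensorOperator.
Variables (R : comPzRingType) (P Q : finType).

Definition tensor_up (U : P -> P -> R) (V : Q -> Q -> R) (x y : P * Q) : R :=
  U x.1 y.1 * (x.2 == y.2)%:R + (x.1 == y.1)%:R * V x.2 y.2.

Lemma sum_delta (I : finType) (F : I -> R) (i : I) :
  \sum_j (i == j)%:R * F j = F i.
Proof.
rewrite (bigD1 i) //= eqxx mul1r big1 ?addr0 // => j.
by rewrite eq_sym => /negPf->; rewrite mul0r.
Qed.

(** The two mixed terms are exchanged when [U] and [V] are both transposed, so they drop out of the
    commutator. *)
Lemma tensor_up_gram (U : P -> P -> R) (V : Q -> Q -> R) (x y : P * Q) :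
  \sum_z tensor_up U V x z * tensor_up U V y z =
  (x.2 == y.2)%:R * (\sum_a U x.1 a * U y.1 a) + U x.1 y.1 * V y.2 x.2 +
  (U y.1 x.1 * V x.2 y.2 + (x.1 == y.1)%:R * (\sum_b V x.2 b * V y.2 b)).
Proof.
case: x y => [x1 x2] [y1 y2]; rewrite /tensor_up /=.
transitivity (\sum_a \sum_b (
    (x2 == b)%:R * ((y2 == b)%:R * (U x1 a * U y1 a)) +
    (y1 == a)%:R * ((x2 == b)%:R * (U x1 a * V y2 b)) +
    ((x1 == a)%:R * ((y2 == b)%:R * (U y1 a * V x2 b)) +
    (x1 == a)%:R * ((y1 == a)%:R * (V x2 b * V y2 b))))).
  by rewrite pair_bigA /=; apply: eq_bigr => -[a b] _ /=; ring.
transitivity (\sum_a (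
    (y2 == x2)%:R * (U x1 a * U y1 a) + (y1 == a)%:R * (U x1 a * V y2 x2) +
    ((x1 == a)%:R * (U y1 a * V x2 y2) +
    (x1 == a)%:R * ((y1 == a)%:R * (\sum_b V x2 b * V y2 b))))).
  apply: eq_bigr => a _; rewrite !big_split /= sum_delta -!mulr_sumr.
  rewrite (sum_delta (fun b => U x1 a * V y2 b)).
  by rewrite (sum_delta (fun b => U y1 a * V x2 b)).
rewrite !big_split /= -mulr_sumr !sum_delta.
by rewrite (eq_sym y2) (eq_sym y1).
Qed.

Lemma tensor_up_comm (U : P -> P -> R) (V : Q -> Q -> R)
    (h : P -> R) (k : Q -> R) :
  (forall x y, \sum_z U x z * U y z - \sum_z U z x * U z y = (x == y)%:R * h x) ->
  (forall x y, \sum_z V x z * V y z - \sum_z V z x * V z y = (x == y)%:R * k x) ->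
  forall x y, \sum_z tensor_up U V x z * tensor_up U V y z -
    \sum_z tensor_up U V z x * tensor_up U V z y =
    (x == y)%:R * (h x.1 + k x.2).
Proof.
move=> cU cV x y; rewrite tensor_up_gram.
have -> : \sum_z tensor_up U V z x * tensor_up U V z y =
    \sum_z tensor_up (fun a b => U b a) (fun a b => V b a) x z *
           tensor_up (fun a b => U b a) (fun a b => V b a) y z.
  by apply: eq_bigr => z _; rewrite /tensor_up !(eq_sym z.1) !(eq_sym z.2).
rewrite tensor_up_gram.
have -> : (x == y)%:R = (x.1 == y.1)%:R * (x.2 == y.2)%:R :> R.
  by rewrite -natrM mulnb; case: x y => [? ?] [].
have -> : (x.1 == y.1)%:R * (x.2 == y.2)%:R * (h x.1 + k x.2) =
    (x.2 == y.2)%:R * ((x.1 == y.1)%:R * h x.1) +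
    (x.1 == y.1)%:R * ((x.2 == y.2)%:R * k x.2) by ring.
by rewrite -cU -cV; ring.
Qed.

End TensorOperator.

Lemma tensor_up_neq0 (R : idomainType) (P Q : finType) (U : P -> P -> R)
    (V : Q -> Q -> R) (x y : P * Q) : tensor_up U V x y != 0 ->
  (U x.1 y.1 != 0 /\ x.2 = y.2) \/ (x.1 = y.1 /\ V x.2 y.2 != 0).
Proof.
rewrite /tensor_up; have [->|nU] := eqVneq (U x.1 y.1) 0; rewrite ?mul0r ?add0r.
  by have [->|] := eqVneq x.1 y.1; rewrite ?mul1r ?mul0r ?eqxx //; right.
have [->|n2] := eqVneq x.2 y.2; first by left.
by have [->|] := eqVneq x.1 y.1; rewrite mulr0 add0r ?mul1r ?mul0r ?eqxx //; right.
Qed.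

(** * Words, their encoding by 0/1 strings, and pairings with increasing sequences *)

Section Words.
Variable R : realFieldType.
Implicit Types (c : R) (u v y : seq R) (s : seq bool).

Definition seq_dot u v : R := \sum_(p <- zip u v) p.1 * p.2.

Lemma seq_dot_cons (a b : R) u v :
  seq_dot (a :: u) (b :: v) = a * b + seq_dot u v.
Proof. by rewrite /seq_dot big_cons. Qed.

(** All increasing [v] are allowed because inserting copies of the smallest letter pairs the shorter
    word with a subsequence of [v]. *)
Definition word_lt u u' := forall v, sorted <%R v -> size v = size u ->
  seq_dot u v < seq_dot u' v.

(* The default letter [c] for an exhausted [y] is never reached when
   [count id s = size y]. *)
Fixpoint merge_word c s y : seq R :=
  match s with
  | [::] => [::]
  | true :: s' => head c y :: merge_word c s' (behead y)
  | false :: s' => c :: merge_word c s' y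
  end.

Lemma size_merge_word c s y : size (merge_word c s y) = size s.
Proof. by elim: s y => [|[] s IH] y //=; rewrite IH. Qed.

Lemma seq_dot_merge_word c s y v : size v = size s -> count id s = size y ->
  seq_dot (merge_word c s y) v =
  c * \sum_(x <- mask (map negb s) v) x + seq_dot y (mask s v).
Proof.
elim: s y v => [|[] s IH] y [|b v] //=.
- by case: y => // _ _; rewrite /seq_dot !big_nil mulr0 addr0.
- case: y => [|z y] //= [sv] [sy].
  by rewrite !seq_dot_cons IH //; ring.
- by move=> [sv] sy; rewrite seq_dot_cons IH // big_cons; ring.
Qed.

(** The move exchanges [c] with a letter z > c at neighbouring places carrying b0 < b1, which adds
    (z - c)(b1 - b0) to the pairing. *)
Lemma merge_word_lt_raise c (A B : seq bool) y :
  count id (A ++ true :: false :: B) = size y -> all (> c) y ->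
  word_lt (merge_word c (A ++ true :: false :: B) y)
          (merge_word c (A ++ false :: true :: B) y).
Proof.
move=> cy yc v sv; rewrite size_merge_word => szv.
elim: A y v cy yc sv szv => [|b A IH] y [|b0 v] //=.
  case: y v => [|z y] [|b1 v] //= _ /andP[cz _] /andP[b01 _] _.
  rewrite !seq_dot_cons !addrA ltrD2r -subr_gt0.
  have -> : c * b0 + z * b1 - (z * b0 + c * b1) = (z - c) * (b1 - b0) by ring.
  by rewrite mulr_gt0 ?subr_gt0.
have ps : path <%R b0 v -> sorted <%R v by apply: path_sorted.
case: b => /=.
  case: y => [|z y] //= [cy] /andP[_ yc] /ps sv [szv].
  by rewrite !seq_dot_cons ltrD2l IH.
by move=> cy yc /ps sv [szv]; rewrite !seq_dot_cons ltrD2l IH.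
Qed.

(** The copies of [c] contribute equally to both sides, and the remaining places carry a subsequence
    of [v], which is again increasing. *)
Lemma merge_word_lt c s y y' : count id s = size y -> size y = size y' ->
  word_lt y y' -> word_lt (merge_word c s y) (merge_word c s y').
Proof.
move=> sy yy' lty v sv; rewrite size_merge_word => szv.
rewrite !seq_dot_merge_word -?yy' // ltrD2l; apply: lty.
  exact: sorted_mask lt_trans _ _ sv.
by rewrite size_mask.
Qed.

(** With [filter_merge_word] this recovers [s] and [y] from the merged word, so the encoding is
    injective; [merge_word_split] gives surjectivity. *)
Lemma map_merge_word c s y : count id s = size y -> c \notin y ->
  [seq x != c | x <- merge_word c s y] = s.
Proof.
elim: s y => [|[] s IH] y //=; last by move=> sy cy; rewrite eqxx IH.
case: y => // z y [sy]; rewrite inE eq_sym => /norP[zc cy] /=.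
by rewrite zc IH.
Qed.

Lemma filter_merge_word c s y : count id s = size y -> c \notin y ->
  [seq x <- merge_word c s y | x != c] = y.
Proof.
elim: s y => [|[] s IH] y /=; first by case: y.
  case: y => // z y [sy]; rewrite inE eq_sym => /norP[zc cy] /=.
  by rewrite zc IH.
by move=> sy cy; rewrite eqxx IH.
Qed.

Lemma merge_word_split c u :
  merge_word c [seq x != c | x <- u] [seq x <- u | x != c] = u.
Proof. by elim: u => //= x u IH; case: eqVneq => [->|] /=; rewrite IH. Qed.

Lemma perm_merge_word c s y : count id s = size y ->
  perm_eq (merge_word c s y) (nseq (size s - size y) c ++ y).
Proof.
elim: s y => [|[] s IH] y //=; first by case: y.
  case: y => // z y [sy] /=; rewrite subSS perm_sym perm_catC /= perm_cons.
  by rewrite perm_catC perm_sym IH.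
move=> sy; rewrite subSn /= ?perm_cons ?IH // -sy; exact: count_size.
Qed.

End Words.

(** * Recursive models of the rearrangements of a multiset *)

Definition block_word (R : realFieldType) (bs : seq (nat * R)) : seq R :=
  flatten [seq nseq p.1 p.2 | p <- bs].

Lemma size_block_word (R : realFieldType) (bs : seq (nat * R)) :
  size (block_word bs) = sumn (unzip1 bs).
Proof. by elim: bs => //= p bs IH; rewrite size_cat size_nseq IH. Qed.

Lemma block_word_gt (R : realFieldType) (c : R) (bs : seq (nat * R)) :
  path <%R c (unzip2 bs) -> all (> c) (block_word bs).
Proof.
rewrite path_sortedE; last exact: lt_trans.
case/andP => + _; elim: bs => //= p bs IH /andP[cp /IH].
by rewrite all_cat => ->; rewrite all_nseq cp orbT.
Qed.

(* The elements satisfying [wm_ok] encode the rearrangements of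
   [block_word bs]; [wm_up] extends to the other ones so that sums range over
   the whole type. *)
Record word_model (R : rcfType) (bs : seq (nat * R)) := WordModel {
  wm_type : finType;
  wm_word : wm_type -> seq R;
  wm_ok : pred wm_type;
  wm_rank : wm_type -> nat;
  wm_up : wm_type -> wm_type -> R;
  wm_weight : wm_type -> R;
  wm_top : nat;
  wm_word_perm : forall x, wm_ok x -> perm_eq (wm_word x) (block_word bs);
  wm_word_inj : {in wm_ok &, injective wm_word};
  wm_word_onto : forall u, perm_eq u (block_word bs) ->
    exists2 x, wm_ok x & wm_word x = u;
  wm_up_ok : forall x y, wm_up x y != 0 -> wm_ok x = wm_ok y;
  wm_up_lt : forall x y, wm_up x y != 0 -> wm_ok x ->
    wm_rank y = (wm_rank x).+1 /\ word_lt (wm_word x) (wm_word y);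
  wm_comm : forall x y,
    \sum_z wm_up x z * wm_up y z - \sum_z wm_up z x * wm_up z y =
    (x == y)%:R * wm_weight x;
  wm_weightE : forall x, wm_ok x ->
    wm_weight x = wm_top%:R - 2 * (wm_rank x)%:R;
  wm_gf : (\sum_(x | wm_ok x) 'X^(wm_rank x)) *
    \prod_(a <- unzip1 bs) qfact a = qfact (sumn (unzip1 bs))
}.

Definition word_model_nil (R : rcfType) : word_model (Nil (nat * R)).
Proof.
apply: (@WordModel R [::] unit (fun=> [::]) xpredT (fun=> 0%N) (fun _ _ => 0)
  (fun=> 0) 0).
- by [].
- by case=> [] [].
- by move=> u; rewrite /block_word /= => /perm_nilP->; exists tt.
- by [].
- by move=> x y /eqP.
- by move=> x y; rewrite !big1 ?subrr ?mulr0 // => *; rewrite mul0r.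
- by move=> x _; rewrite mulr0 subrr.
- by rewrite big_nil sumr_const card_unit mulr1 qfact0.
Qed.

(** As [c] is smaller than the other letters, an element is a 0/1 string marking the places of the
    others, together with an element of the smaller model filling them. The operator is a tensor
    sum, so ranks and weights add. *)
Lemma word_model_cons (R : rcfType) (a : nat) (c : R) (bs : seq (nat * R)) :
  path <%R c (unzip2 bs) -> word_model bs -> word_model ((a, c) :: bs).
Proof.
move=> sbs [P word ok rk U h N wperm winj wonto Uok Ult comm hE gf].
set b := sumn (unzip1 bs).
have gtc y : perm_eq y (block_word bs) -> all (> c) y.
  by move/perm_all->; apply: block_word_gt.
have notc y : perm_eq y (block_word bs) -> c \notin y.
  by move/gtc/allP => yc; apply/negP => /yc; rewrite ltxx.
have szw x : ok x -> size (word x) = b.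
  by move/wperm/perm_size->; rewrite size_block_word.
pose ok' (x : (a + b).-tuple bool * P) := (count id x.1 == b) && ok x.2.
apply: (@WordModel R ((a, c) :: bs) ((a + b).-tuple bool * P)%type (fun x => merge_word c x.1 (word x.2))
  ok' (fun x => inversions x.1 + rk x.2)%N (tensor_up (@bit_up R (a + b)) U)
  (fun x => bit_weight R x.1 + h x.2) (b * a + N)%N).
- move=> [S x] /andP[/eqP /= cS okx].
  have cSw : count id S = size (word x) by rewrite szw.
  rewrite (permPl (perm_merge_word c cSw)) size_tuple -cSw cS addnK.
  by rewrite perm_cat2l wperm.
- move=> [S x] [T y] /andP[/eqP /= cS okx] /andP[/eqP /= cT oky] e.
  have cSw : count id S = size (word x) by rewrite szw.
  have cTw : count id T = size (word y) by rewrite szw.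
  have := map_merge_word cSw (notc _ (wperm _ okx)).
  have := filter_merge_word cSw (notc _ (wperm _ okx)).
  rewrite e (map_merge_word cTw (notc _ (wperm _ oky))).
  rewrite (filter_merge_word cTw (notc _ (wperm _ oky))).
  by move=> /winj -> // /val_inj ->.
- move=> u; rewrite /block_word /= -/(block_word bs) => pu.
  have fy : perm_eq [seq x <- u | x != c] (block_word bs).
    have := perm_filter (predC1 c) pu; rewrite filter_cat.
    rewrite [X in X ++ _](_ : _ = [::]); last first.
      by apply/nilP; rewrite /nilp size_filter count_nseq /= eqxx.
    rewrite [X in perm_eq _ X](_ : _ = block_word bs) //.
    apply/all_filterP/allP => z zin /=; apply: contraNneq (notc _ (perm_refl _)).
    by move=> <-.
  have [y oky wy] := wonto _ fy.
  have szu : size [seq x != c | x <- u] == (a + b)%N.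
    by rewrite size_map (perm_size pu) size_cat size_nseq size_block_word.
  exists (Tuple szu, y); last by rewrite /= wy merge_word_split.
  rewrite /ok' oky andbT /= -(szw y oky) wy size_filter count_map.
  by apply/eqP/eq_count.
- move=> [S x] [T y] /tensor_up_neq0[] /= [].
    move=> /bit_up_neq0[A [B [eS eT]]] ->.
    by rewrite /ok' /= eS eT count_raise.
  by move=> -> /Uok; rewrite /ok' /= => ->.
- move=> [S x] [T y] /tensor_up_neq0[] /= [].
    move=> /bit_up_neq0[A [B [eS eT]]] <- /andP[/= /eqP cS okx].
    rewrite eT eS inversions_raise addSn; split=> //.
    by apply: merge_word_lt_raise; rewrite -?eS ?cS ?szw // gtc // wperm.
  move=> <- Uxy /andP[/= /eqP cS okx].
  have [-> wlt] := Ult _ _ Uxy okx; rewrite addnS; split=> //.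
  have oky : ok y by rewrite -(Uok _ _ Uxy).
  by apply: merge_word_lt; rewrite ?szw.
- by apply: tensor_up_comm => //; apply: bit_up_comm.
(* A string of length a + b with b ones has weight ba minus twice its inversions, whence the summand
   [b * a] of the top. *)
- move=> [S x] /andP[/= /eqP cS okx].
  rewrite bit_weightE cS hE // !natrD natrM; ring.
(* The sum over pairs factors into the Gaussian binomial coefficient and the generating function of
   the smaller model. *)
- rewrite /= big_cons -/b -(qbinomial_sumP a b) -[in RHS]gf /qbinomial_sum.
  rewrite -(pair_big (fun S : (a + b).-tuple bool => count id S == b) ok
    (fun S x => 'X^(inversions S + rk x))) /=.
  have -> : \sum_(S : (a + b).-tuple bool | count id S == b)
      \sum_(x | ok x) 'X^(inversions S + rk x) =
    (\sum_(S : (a + b).-tuple bool | count id S == b) 'X^(inversions S)) *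
    (\sum_(x | ok x) 'X^(rk x)) :> {poly int}.
    rewrite mulr_suml; apply: eq_bigr => S _; rewrite mulr_sumr.
    by apply: eq_bigr => x _; rewrite exprD.
  ring.
Qed.

Lemma word_model_exists (R : rcfType) (bs : seq (nat * R)) :
  sorted <%R (unzip2 bs) -> word_model bs.
Proof.
elim: bs => [|[a c] bs IH] /= sbs; first exact: word_model_nil.
by apply: word_model_cons => //; apply: IH; apply: path_sorted sbs.
Qed.

(** * Constant blocks of a sorted sequence *)

Definition seq_block_ends (R : realFieldType) (s : seq R) : seq nat :=
  [seq k <- iota 1 (size s) | (k == size s) || (s`_k.-1 < s`_k)].

Lemma seq_block_ends_cons (R : realFieldType) (x y : R) (s : seq R) :
  seq_block_ends [:: x, y & s] =
  (if x < y then [:: 1%N] else [::]) ++ map succn (seq_block_ends (y :: s)).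
Proof.
rewrite /seq_block_ends.
have -> : iota 1 (size [:: x, y & s]) =
    [:: 1%N] ++ map succn (iota 1 (size (y :: s))) by rewrite -(iotaDl 1 1).
rewrite filter_cat filter_map; congr (_ ++ map _ _).
by apply: eq_in_filter => k; rewrite mem_iota; case: k.
Qed.

Lemma pairmap_subn_succ (z : nat) (e : seq nat) :
  pairmap (fun a b => b - a)%N z.+1 (map succn e) =
  pairmap (fun a b => b - a)%N z e.
Proof. by elim: e z => //= a e IH z; rewrite IH subSS. Qed.

(** Induction on the sequence, which is why [seq_block_ends] takes an arbitrary one: a new first
    letter opens a block of length 1 if it is smaller than the next letter, and lengthens the first
    block otherwise. *)
Lemma block_decomposition (R : realFieldType) (s : seq R) : sorted <=%R s ->
  exists bs : seq (nat * R),
    [/\ unzip1 bs = pairmap (fun a b => b - a)%N 0%N (seq_block_ends s),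
        sorted <%R (unzip2 bs) & block_word bs = s].
Proof.
elim: s => [|x [|y s] IH] /=; first by exists [::].
  by exists [:: (1%N, x)].
move=> /andP[lexy /IH[[|[a c] bs] [e1 e2 e3]]]; first by [].
have cy : a != 0%N -> c = y.
  by case: a e1 e2 e3 => // a _ _; rewrite /block_word /= => -[].
(* Block ends start from 1, so the first block is nonempty and its letter [c] can be read off the
   sequence. *)
have a0 : a != 0%N.
  case: a e1 {e2 e3 cy} => //=.
  rewrite /seq_block_ends; set e := filter _ _ => ee.
  have : all (leq 1) e by apply/allP => k; rewrite mem_filter mem_iota => /and3P[].
  by case: e ee => //= k e [+ _]; rewrite subn0 => <-.
move: e2 e3; rewrite (cy a0) {cy} => e2 e3.
rewrite seq_block_ends_cons; have [ltxy|geyx] := ltP x y.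
  exists [:: (1%N, x), (a, y) & bs]; split=> /=.
  - by rewrite pairmap_subn_succ -e1.
  - by rewrite ltxy.
  - by rewrite /block_word /= in e3 *; rewrite e3.
have -> : x = y by apply/eqP; rewrite eq_le lexy.
exists ((a.+1, y) :: bs); split=> //=.
  case: (seq_block_ends (y :: s)) e1 => [|k e] //= [-> ->].
  by rewrite pairmap_subn_succ !subn0.
by rewrite /block_word /= in e3 *; rewrite e3.
Qed.

Lemma composition_of_blocks (R : realType) (n : nat) (w : 'rV[R]_n) :
  exists bs : seq (nat * R),
    [/\ unzip1 bs = composition_of w, sorted <%R (unzip2 bs) &
        block_word bs = increasing_rearrangement w].
Proof.
have sw : sorted <=%R (increasing_rearrangement w).
  by apply: sort_sorted; apply: le_total.
have [bs [e1 e2 e3]] := block_decomposition sw; exists bs; split=> //.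
by rewrite e1 /seq_block_ends size_increasing_rearrangement.
Qed.

(** * Coefficients of the q-multinomial and cardinalities in a model *)

Lemma horner_qfact (n : nat) : (qfact n).[1] = n`!%:R.
Proof.
elim: n => [|n IH]; first by rewrite qfact0 hornerE.
rewrite qfactS hornerM IH factS mulnC natrM; congr (_ * _).
rewrite /qint horner_sum (eq_bigr (fun=> 1)) => [|i _]; last first.
  by rewrite hornerXn expr1n.
by rewrite sumr_const card_ord.
Qed.

(** Past the degree the coefficient is 0, which nonnegativity puts below the constant
    coefficient. *)
Lemma max_coef_ge (f : {poly int}) (m : nat) :
  (forall i, 0 <= f`_i) -> f`_m <= max_coef f.
Proof.
move=> f0; rewrite /max_coef; have [ltm|gem] := ltnP m (size f).
  exact: (le_bigmax f`_0 (fun i : 'I_(size f) => f`_i) (Ordinal ltm)).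
by rewrite nth_default //; apply: le_trans (f0 0%N) _; apply: bigmax_ge_id.
Qed.

Lemma seq_dot_mktuple (R : realFieldType) (n : nat) (f g : 'I_n -> R) :
  seq_dot (mktuple f) (mktuple g) = \sum_(i < n) f i * g i.
Proof. by rewrite /seq_dot /= zip_map big_map big_enum. Qed.

Section ModelCounting.
Variables (R : rcfType) (bs : seq (nat * R)) (M : word_model bs).

Lemma wm_card_middle (v : seq R) (t : R) : sorted <%R v ->
  size v = size (block_word bs) ->
  (#|[set x | @wm_ok _ _ M x & seq_dot (wm_word x) v == t]| <=
   #|[set x | @wm_ok _ _ M x & wm_rank x == (wm_top M)./2]|)%N.
Proof.
move=> sv szv.
apply: (level_set_le_middle_rank (@wm_comm _ _ M) (@wm_weightE _ _ M)
  (@wm_up_ok _ _ M)) => x y Uxy okx.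
have [-> lt] := wm_up_lt Uxy okx; split=> //.
by apply: lt => //; rewrite (perm_size (wm_word_perm okx)).
Qed.

(** The generating function identity evaluated at q = 1. *)
Lemma wm_card_fact : (#|[set x | @wm_ok _ _ M x]| * comp_fact (unzip1 bs))%N =
  (sumn (unzip1 bs))`!.
Proof.
have := congr1 (fun p : {poly int} => p.[1]) (wm_gf M).
rewrite hornerM horner_sum horner_prod horner_qfact.
rewrite [X in X * _](eq_bigr (fun=> 1)) => [|x _]; last first.
  by rewrite hornerXn expr1n.
rewrite [X in _ * X](eq_bigr (fun a => a`!%:R)) => [|a _]; last first.
  exact: horner_qfact.
rewrite sumr_const -natr_prod -natrM => /eqP; rewrite eqr_nat => /eqP <-.
by rewrite cardsE.
Qed.

(** The q-multinomial and the rank generating function have the same product with the monic, hence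
    cancellable, denominator. *)
Lemma wm_coef_qmultinomial (m : nat) :
  (qmultinomial (sumn (unzip1 bs)) (unzip1 bs))`_m =
  #|[set x | @wm_ok _ _ M x & wm_rank x == m]|%:R.
Proof.
have monic_q : \prod_(a <- unzip1 bs) qfact a \is monic.
  by apply: monic_prod => a _; apply: qfact_monic.
have -> : qmultinomial (sumn (unzip1 bs)) (unzip1 bs) =
    \sum_(x | @wm_ok _ _ M x) 'X^(wm_rank x).
  apply: (mulIf (monic_neq0 monic_q)).
  by rewrite qmultinomialK // wm_gf.
rewrite coef_sum -sum1_card natr_sum [LHS]big_mkcond [RHS]big_mkcond /=.
apply: eq_bigr => x _; rewrite coefXn inE eq_sym.
by case: wm_ok => //=; case: eqP.
Qed.

End ModelCounting.

(** * Passage from permutations to words *)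

Theorem theorem2p2 (R : realType) (n : nat) (v w : 'rV[R]_n)
    (v_distinct : forall i j : 'I_n, i <> j -> v 0 i <> v 0 j) :
  (orth_count v w)%:Z <=
    (comp_fact (composition_of w))%:Z *
    max_coef (qmultinomial n (composition_of w)).
Proof.
have [bs [bs1 bs2 bsw]] := composition_of_blocks w.
pose M := word_model_exists bs2.
have sumbs : sumn (unzip1 bs) = n by rewrite bs1 sumn_composition_of.
pose tv := [tuple v 0 i | i < n]; pose tw := [tuple w 0 i | i < n].
have perm_w : perm_eq (block_word bs) tw by rewrite bsw perm_sort.
set v' := increasing_rearrangement v.
have /tuple_permP[p v'E] : perm_eq v' tv by rewrite perm_sort.
have sv' : sorted <%R v'.
  rewrite lt_sorted_uniq_le sort_uniq sort_sorted ?andbT; last exact: le_total.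
  rewrite map_inj_uniq ?enum_uniq // => i j eij.
  by apply/eqP/negPn/negP => /eqP/v_distinct; rewrite eij.
(* [p] sorts [v]; the substitution i = s(p j) turns the dot product into the pairing of this word
   with [v']. *)
pose g (s : 'S_n) := [tuple w 0 (s (p j)) | j < n].
have dotE s : dot w (perm_act s v) = seq_dot (g s) v'.
  rewrite v'E seq_dot_mktuple /dot (reindex (fun j => s (p j))) /=.
    by apply: eq_bigr => j _; rewrite !mxE permK tnth_mktuple.
  by exists (fun i => (p^-1)%g ((s^-1)%g i)) => i _; rewrite ?permK ?permKV.
have g_word s : exists2 x : wm_type M, wm_ok x & wm_word x = g s.
  apply: wm_word_onto.
  rewrite perm_sym (perm_trans perm_w) // perm_sym; apply/tuple_permP.
  exists (p * s)%g; congr val; apply: eq_from_tnth => j.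
  by rewrite !tnth_mktuple permM.
have [f fok fg] := fin_all_exists2 g_word.
(* Permutations giving the same word form a translate of [stab], so every word is reached equally
   often. *)
pose stab := [set s : 'S_n | [forall j, w 0 (s j) == w 0 j]].
have fiber x : wm_ok x -> #|[set s | f s == x]| = #|stab|.
  move=> okx; have := perm_trans (wm_word_perm okx) perm_w.
  (* [q] spells the word of [x] as w_{q(j)}, and [s0] is chosen so that s0(p j) = q j. *)
  case/tuple_permP => q xq; pose s0 := (p^-1 * q)%g.
  have gs0 : val (g s0) = wm_word x.
    rewrite xq; congr val; apply: eq_from_tnth => j.
    by rewrite !tnth_mktuple permM permK.
  rewrite -(card_lcoset stab s0); apply: eq_card => s.
  rewrite mem_lcoset !inE; apply/eqP/forallP => [fs j|ws].
    have e : g s = g s0 by apply: val_inj; rewrite gs0 -fs; apply/esym/fg.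
    have := congr1 (fun t => tnth t ((p^-1)%g ((s0^-1)%g j))) e.
    by rewrite !tnth_mktuple !permKV permM => ->.
  apply: (@wm_word_inj _ _ M); rewrite ?inE //; first exact: fok.
  rewrite fg -gs0; congr val; apply: eq_from_tnth => j.
  by rewrite !tnth_mktuple; have /eqP := ws (s0 (p j)); rewrite permM permK.
have count_fibers (A : pred (wm_type M)) :
    #|[set s | A (f s)]| = (#|[set x | wm_ok x & A x]| * #|stab|)%N.
  rewrite -sum1_card (partition_big f (mem [set x | wm_ok x & A x])) /=.
    rewrite -sum_nat_const; apply: eq_bigr => x; rewrite inE => /andP[okx Ax].
    rewrite -(fiber x okx) -sum1_card; apply: eq_bigl => s.
    by rewrite !inE; case: eqP => [->|]; rewrite ?Ax ?andbF.
  by move=> s; rewrite !inE => ->; rewrite fok.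
(* Double counting: n! is the number of words times the size of [stab] by the fibres, and times the
   product of the block factorials by the model. *)
have stabE : #|stab| = comp_fact (composition_of w).
  have := count_fibers xpredT.
  have -> : #|[set s : 'S_n | true]| = n`!.
    by rewrite -[RHS]card_Sn; apply: eq_card => s; rewrite !inE.
  have := wm_card_fact M; rewrite sumbs bs1 => <-.
  have -> : [set x : wm_type M | wm_ok x & true] = [set x | wm_ok x].
    by apply/setP => x; rewrite !inE andbT.
  move/eqP; rewrite eqn_pmul2l => [/eqP->//|].
  have := wm_card_fact M; rewrite sumbs; case: #|_| => // e.
  by have := fact_gt0 n; rewrite -e mul0n.
have -> : orth_count v w = (#|[set x | @wm_ok _ _ M x &
    seq_dot (wm_word x) v' == 0%R]| * #|stab|)%N.
  rewrite -(count_fibers (fun x => seq_dot (wm_word x) v' == 0)).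
  by apply: eq_card => s; rewrite !inE dotE fg.
rewrite mulnC PoszM stabE ler_wpM2l //.
have coefE := wm_coef_qmultinomial M; rewrite sumbs bs1 in coefE.
(* The words pairing to zero form a level set, bounded by the coefficient at the middle rank. *)
apply: (@le_trans _ _ (qmultinomial n (composition_of w))`_((wm_top M)./2)).
  rewrite coefE natz lez_nat; apply: wm_card_middle => //.
  by rewrite (perm_size perm_w) size_increasing_rearrangement size_tuple.
by apply: max_coef_ge => i; rewrite coefE.
Qed.
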